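(* Let $n\ge 7$ be an integer and let $\gamma\ge 5$ and $1/20 > \epsilon>0$ be real numbers. Let $\mathbb{J}$ be the $n\times n$ matrix with ones on the super-diagonal and zeros everywhere else (a Jordan block with eigenvalue zero), and let $R$ be any $n\times n$ matrix in which each entry is $n^{-\gamma}$ or $-n^{-\gamma}$. If $n \le \frac12 \gamma \log \gamma$, then there are at most $O_\epsilon(1)$ eigenvalues of $\mathbb{J}+R$ that fall outside the disk with radius $1/4-\epsilon$ centered at the origin, and if $n \ge 2 \gamma \log \gamma$, then there are at most $O_\epsilon(1)$ eigenvalues of $\mathbb{J}+R$ that fall inside the disk with radius $1/4-\epsilon$ centered at the origin.
   Context: Eigenvalues are counted with algebraic multiplicity; $\log$ is the natural logarithm. $O_\epsilon(1)$ denotes a quantity bounded by a constant depending only on $\epsilon$ (not on $n$, $\gamma$, or the choice of signs in $R$). *)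

(* Defs.v *)
From HB Require Import structures.
From mathcomp Require Import all_boot all_order all_algebra.
From mathcomp Require Export complex.
Set Implicit Arguments.
Unset Strict Implicit.
Unset Printing Implicit Defensive.
Import Order.TTheory GRing.Theory Num.Theory.
Local Open Scope ring_scope.
Local Open Scope complex_scope.

Definition shift_mx (K : pzSemiRingType) (n : nat) : 'M[K]_n :=
  \matrix_(i, j) (j == i.+1 :> nat)%:R.

Definition sign_mx (K : pzRingType) (n : nat) (a : K) (A : 'M[K]_n) : Prop :=
  forall i j, A i j = a \/ A i j = - a.

(* The roots of the (monic) characteristic polynomial, listed with
   multiplicity; the order of the list is irrelevant. *)
Definition eigenvalues (F : closedFieldType) (n : nat) (A : 'M[F]_n) : seq F :=
  sval (closed_field_poly_normal (char_poly A)).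

Lemma eigenvaluesP (F : closedFieldType) (n : nat) (A : 'M[F]_n) :
  char_poly A = \prod_(z <- eigenvalues A) ('X - z%:P).
Proof.
rewrite /eigenvalues; case: closed_field_poly_normal => s /= {1}->.
by rewrite (monicP (char_poly_monic A)) scale1r.
Qed.

(* Disks are closed. The modulus `|z| is a nonnegative real number seen as an
   element of R[i], hence the comparison with r%:C. *)
Definition in_disk (R : rcfType) (r : R) (z : R[i]) : bool := `|z| <= r%:C.

Definition num_eig_inside (R : rcfType) (n : nat) (r : R)
    (A : 'M[R[i]]_n) : nat :=
  count (fun z => in_disk r z) (eigenvalues A).

Definition num_eig_outside (R : rcfType) (n : nat) (r : R)
    (A : 'M[R[i]]_n) : nat :=
  count (fun z => ~~ in_disk r z) (eigenvalues A).

(* Main.v *)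
Require Import Defs.
From mathcomp Require Import all_boot all_order all_algebra.
From mathcomp Require Import reals exp.
From mathcomp Require Import perm ring lra zify.
Import Order.TTheory GRing.Theory Num.Theory.
Import Normc.
Set Implicit Arguments.
Unset Strict Implicit.
Local Open Scope ring_scope.
Local Open Scope complex_scope.

(* Let [delta = n^-gamma], let [J] be the Jordan block and [E] the sign matrix.

   First regime. If [z] is an eigenvalue of [J + E] with left eigenvector [v],
   then [z v_j = v_(j-1) + O(delta)], which forces [|v_j| <= (j+1) 5^(j+1) delta
   sum |v_k|] when [|z| >= 1/5]. Unless [n <= 200], the hypothesis gives
   [n^2 5^n delta < 1], so that no eigenvalue lies outside the disk.

   Second regime. Now [3^-n <= delta] and [n^5 delta <= 1]. Let [p] be the
   characteristic polynomial. Its constant term is [+- E_(n,1)] up to a small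
   relative error, hence at least [delta / 2] in modulus, whereas the weighted
   norm [sum |p_k| 3^-k] is at most [26 delta]. A Landau (Jensen) type inequality
   then bounds the number of roots of modulus at most [1/4 < 1/3] by an absolute
   constant. Both estimates of [p] come from one weighted version of the bound of
   a determinant by the product of its row sums, in which the Leibniz term of the
   cyclic permutation is isolated. *)

(** * Submultiplicative norms and determinants *)

(** Met both by the modulus on [R[i]] and by a weighted coefficient norm on polynomials, so that one
    determinant bound serves both estimates. *)
Record submult_norm (A : comPzRingType) (R : realFieldType) (f : A -> R) : Prop :=
  SubmultNorm {
    sn_ge0 : forall x, 0 <= f x;
    sn_0 : f 0 = 0;
    sn_1 : f 1 = 1;
    sn_N : forall x, f (- x) = f x;
    sn_D : forall x y, f (x + y) <= f x + f y;
    sn_M : forall x y, f (x * y) <= f x * f y }.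

Lemma sn_sum (A : comPzRingType) (R : realFieldType) (f : A -> R) (I : Type)
    (r : seq I) (P : pred I) (F : I -> A) : submult_norm f ->
  f (\sum_(i <- r | P i) F i) <= \sum_(i <- r | P i) f (F i).
Proof.
move=> fP; elim/big_rec2: _ => [|i y x _ le_xy]; first by rewrite (sn_0 fP).
by apply: le_trans (sn_D fP _ _) _; rewrite lerD2l.
Qed.

Lemma sn_prod (A : comPzRingType) (R : realFieldType) (f : A -> R) (I : Type)
    (r : seq I) (F : I -> A) : submult_norm f ->
  f (\prod_(i <- r) F i) <= \prod_(i <- r) f (F i).
Proof.
move=> fP; elim/big_rec2: _ => [|i y x _ le_xy]; first by rewrite (sn_1 fP).
by apply: le_trans (sn_M fP _ _) _; rewrite ler_wpM2l ?(sn_ge0 fP).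
Qed.

Lemma sn_signM (A : comPzRingType) (R : realFieldType) (f : A -> R) (b : bool) (x : A) :
  submult_norm f -> f ((-1) ^+ b * x) = f x.
Proof. by move=> fP; rewrite mulr_sign; case: b; rewrite ?(sn_N fP). Qed.

(** Expanding a product of row sums yields all functions, the Leibniz formula only the injective
    ones; the surplus terms are nonnegative. *)
Lemma sum_perm_le_ffun (R : realFieldType) (I : finType) (G : {ffun I -> I} -> R) :
  (forall g, 0 <= G g) -> \sum_(s : {perm I}) G (pval s) <= \sum_g G g.
Proof.
move=> G_ge0.
rewrite [leRHS](bigID (fun g : {ffun I -> I} => injectiveb g)) /= -[leLHS]addr0.
apply: lerD; last by apply: sumr_ge0.
rewrite (reindex (@pval I)) /=.
  by rewrite le_eqVlt; apply/orP; left; apply/eqP/eq_bigl => s; rewrite (valP s).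
exists (insubd (1%g : {perm I})) => /= [s _|g]; first exact: valKd.
by rewrite !inE => g_inj; rewrite insubdK.
Qed.

(* Rescaling column [j] by [d j] and row [i] by [1 / d (s i)] leaves every term
   of the Leibniz expansion unchanged. *)
Lemma sn_det_sub (A : comPzRingType) (R : realFieldType) (f : A -> R) (n : nat)
    (M : 'M[A]_n) (s : 'S_n) (d : 'I_n -> R) :
  submult_norm f -> (forall j, 0 < d j) ->
  f (\det M - (-1) ^+ s * \prod_i M i (s i))
    <= \prod_i (\sum_j f (M i j) * d j / d (s i)) - \prod_i f (M i (s i)).
Proof.
move=> fP d_gt0; rewrite bigA_distr_bigA /=.
set G := fun g : {ffun 'I_n -> 'I_n} => \prod_i (f (M i (g i)) * d (g i) / d (s i)).
have f_ge0 := sn_ge0 fP.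
have G_perm (t : 'S_n) : G (pval t) = \prod_i f (M i (t i)).
  rewrite /G -!pvalE big_split big_split /= -mulrA -[RHS]mulr1; congr (_ * _).
  rewrite prodfV.
  have E (u : 'S_n) : \prod_i d (u i) = \prod_i d i.
    by rewrite [RHS](reindex_inj (@perm_inj _ u)).
  rewrite !pvalE !E divff //; apply/prodf_neq0 => i _; exact: lt0r_neq0.
have G_ge0 g : 0 <= G g.
  apply: prodr_ge0 => i _; rewrite divr_ge0 ?mulr_ge0 //; exact: ltW.
apply: le_trans (lerB (sum_perm_le_ffun G_ge0) (lexx _)).
rewrite /determinant (bigD1 s) //= addrAC subrr add0r.
apply: le_trans (sn_sum _ _ _ fP) _.
rewrite [X in _ <= X - _](bigD1 s) //= G_perm addrAC subrr add0r.
apply: ler_sum => t _; rewrite G_perm sn_signM //; exact: sn_prod.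
Qed.

Lemma sn_det (A : comPzRingType) (R : realFieldType) (f : A -> R) (n : nat)
    (M : 'M[A]_n) (s : 'S_n) (d : 'I_n -> R) :
  submult_norm f -> (forall j, 0 < d j) ->
  f (\det M) <= \prod_i (\sum_j f (M i j) * d j / d (s i)).
Proof.
move=> fP d_gt0; have := sn_det_sub M s fP d_gt0; rewrite lerBrDr.
apply: le_trans; rewrite -{1}[\det M](subrK ((-1) ^+ s * \prod_i M i (s i))).
apply: le_trans (sn_D fP _ _) _.
rewrite lerD2l sn_signM //; exact: sn_prod.
Qed.

Lemma normc_ge0 (R : rcfType) (z : R[i]) : 0 <= normc z.
Proof. by case: z => a b; apply: sqrtr_ge0. Qed.

Lemma normc_submult (R : rcfType) : submult_norm (@normc R).
Proof.
split; [exact: normc_ge0 | exact: normc0 | exact: normc1 | exact: normcN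
  | exact: le_normcD | by move=> x y; rewrite normcM].
Qed.

(** * Weighted norms of polynomials and Landau's inequality *)

(** A coefficient majorant of the sup norm on the disk of radius [rho]; being submultiplicative, it
    can be fed to [sn_det]. *)
Definition l1norm (R : rcfType) (rho : R) (p : {poly R[i]}) : R :=
  \sum_(k < size p) normc p`_k * rho ^+ k.

Lemma l1normE (R : rcfType) (rho : R) (p : {poly R[i]}) (m : nat) :
  (size p <= m)%N -> l1norm rho p = \sum_(k < m) normc p`_k * rho ^+ k.
Proof.
move=> le_pm; rewrite /l1norm -!(big_mkord xpredT (fun k => normc p`_k * rho ^+ k)).
rewrite [RHS](big_cat_nat (n := size p)) //= [X in _ + X]big_nat_cond.
rewrite [X in _ + X]big1 ?addr0 // => k /andP[/andP[le_pk _] _].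
by rewrite nth_default // normc0 mul0r.
Qed.

Lemma l1normC (R : rcfType) (rho : R) (c : R[i]) : l1norm rho c%:P = normc c.
Proof. by rewrite (@l1normE _ _ _ 1%N) ?size_polyC_leq1 // big_ord1 coefC mulr1. Qed.

Lemma l1norm_mulXaddC (R : rcfType) (rho : R) (p : {poly R[i]}) (c : R[i]) :
  l1norm rho (p * 'X + c%:P) = l1norm rho p * rho + normc c.
Proof.
rewrite (@l1normE _ _ _ (size p).+1); last first.
  by rewrite size_MXaddC; case: ifP.
rewrite big_ord_recl coefD coefMX coefC eqxx add0r mulr1 addrC; congr (_ + _).
rewrite mulr_suml; apply: eq_bigr => k _.
by rewrite coefD coefMX coefC /= addr0 exprSr mulrA.
Qed.

Lemma l1norm_submult (R : rcfType) (rho : R) :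
  0 <= rho -> submult_norm (l1norm rho).
Proof.
move=> rho_ge0; have ge0 p : 0 <= l1norm rho p.
  by apply: sumr_ge0 => k _; rewrite mulr_ge0 ?normc_ge0 ?exprn_ge0.
have triang p q : l1norm rho (p + q) <= l1norm rho p + l1norm rho q.
  pose m := maxn (size p) (size q).
  rewrite !(@l1normE _ _ _ m) ?leq_maxl ?leq_maxr ?size_polyD // -big_split /=.
  apply: ler_sum => k _; rewrite -mulrDl ler_wpM2r ?exprn_ge0 // coefD.
  exact: le_normcD.
have normZ c q : l1norm rho (c%:P * q) = normc c * l1norm rho q.
  rewrite mul_polyC !(@l1normE _ _ _ (size q)) ?size_scale_leq // mulr_sumr.
  by apply: eq_bigr => k _; rewrite coefZ normcM mulrA.
split => //.
- by rewrite /l1norm size_poly0 big_ord0.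
- by rewrite -(polyC1) l1normC normc1.
- by move=> p; rewrite /l1norm size_polyN; apply: eq_bigr => k _; rewrite coefN normcN.
(* Horner induction on the left factor: scaling by a constant and multiplication by ['X] act exactly
   on the norm, and [triang] does the rest. *)
move=> p q; elim/poly_ind: p => [|p c IHp].
  by rewrite mul0r /l1norm size_poly0 !big_ord0 mul0r.
rewrite l1norm_mulXaddC !mulrDl; apply: le_trans (triang _ _) _.
rewrite normZ lerD2r mulrAC -[_ * 'X]addr0 -polyC0 l1norm_mulXaddC normc0 addr0.
by rewrite mulrAC ler_wpM2r.
Qed.

Lemma l1normXn (R : rcfType) (rho : R) (k : nat) : l1norm rho 'X^k = rho ^+ k.
Proof.
elim: k => [|k IHk]; first by rewrite expr0 -(polyC1) l1normC normc1.
by rewrite exprSr -[_ * 'X]addr0 -polyC0 l1norm_mulXaddC normc0 addr0 IHk exprSr.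
Qed.

(** By Parseval, the mean of |p|^2 over the circle of radius [rho], written without integrals. *)
Definition l2norm2 (R : rcfType) (rho : R) (p : {poly R[i]}) : R :=
  \sum_(k < size p) normc p`_k ^+ 2 * rho ^+ k.*2.

Lemma l2norm2E (R : rcfType) (rho : R) (p : {poly R[i]}) (m : nat) :
  (size p <= m)%N -> l2norm2 rho p = \sum_(k < m) normc p`_k ^+ 2 * rho ^+ k.*2.
Proof.
move=> le_pm.
rewrite /l2norm2 -!(big_mkord xpredT (fun k => normc p`_k ^+ 2 * rho ^+ k.*2)).
rewrite [RHS](big_cat_nat (n := size p)) //= [X in _ + X]big_nat_cond.
rewrite [X in _ + X]big1 ?addr0 // => k /andP[/andP[le_pk _] _].
by rewrite nth_default // normc0 expr0n mul0r.
Qed.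

Lemma l2norm2_le_l1norm (R : rcfType) (rho : R) (p : {poly R[i]}) :
  0 <= rho -> l2norm2 rho p <= l1norm rho p ^+ 2.
Proof.
move=> rho_ge0; rewrite expr2 {1}/l1norm mulr_suml.
apply: ler_sum => k _.
have x_ge0 j : 0 <= normc p`_j * rho ^+ j by rewrite mulr_ge0 ?normc_ge0 ?exprn_ge0.
rewrite -muln2 exprM -exprMn expr2 ler_wpM2l //.
rewrite /l1norm (bigD1 k) //= lerDl.
exact: sumr_ge0.
Qed.

(** Here [b] and [c] stand for consecutive coefficients of a polynomial; after weighting by
    [rho ^+ k.*2] the right side telescopes in [k]. *)
Lemma normc_blaschke (R : rcfType) (rho : R) (a b c : R[i]) :
  rho ^+ 2 * normc (b - a * c) ^+ 2 - normc ((rho ^+ 2)%:C * c - a^* * b) ^+ 2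
    = (rho ^+ 2 - normc a ^+ 2) * (normc b ^+ 2 - rho ^+ 2 * normc c ^+ 2).
Proof.
have E (x y : R) : normc (x +i* y) ^+ 2 = x ^+ 2 + y ^+ 2.
  by rewrite sqr_sqrtr // addr_ge0 ?sqr_ge0.
case: a => a1 a2; case: b => b1 b2; case: c => c1 c2.
by rewrite /= !E; ring.
Qed.

(* The reflected factor has the same modulus on the circle of radius [rho], up
   to the constant [rho]; here this is a telescoping sum over the coefficients. *)
Lemma l2norm2_blaschke (R : rcfType) (rho : R) (a : R[i]) (q : {poly R[i]}) :
  l2norm2 rho (((rho ^+ 2)%:C%:P - (a^*)%:P * 'X) * q)
    = rho ^+ 2 * l2norm2 rho (('X - a%:P) * q).
Proof.
pose m := (size q).+2.
pose b k := (if k is k'.+1 then q`_k' else 0).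
have cR k : (('X - a%:P) * q)`_k = b k - a * q`_k.
  by rewrite mulrBl coefB coefXM coefCM; case: k.
have cL k : (((rho ^+ 2)%:C%:P - (a^*)%:P * 'X) * q)`_k = (rho ^+ 2)%:C * q`_k - a^* * b k.
  by rewrite mulrBl coefB -mulrA !coefCM coefXM; case: k.
have szM (p : {poly R[i]}) : (size p <= 2)%N -> (size (p * q)%R <= m)%N.
  move=> p2; apply: leq_trans (size_polyMleq _ _) _; rewrite /m; lia.
have sz2 : (size ((rho ^+ 2)%:C%:P - (a^*)%:P * 'X)%R <= 2)%N.
  apply: leq_trans (size_polyD _ _) _; rewrite size_polyN geq_max.
  rewrite (leq_trans (size_polyC_leq1 _)) //= mul_polyC.
  by rewrite (leq_trans (size_scale_leq _ _)) ?size_polyX.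
rewrite !(@l2norm2E _ _ _ m) ?szM ?size_XsubC //.
apply/eqP; rewrite eq_sym -subr_eq0 mulr_sumr -sumrB; apply/eqP.
pose g k := (rho ^+ 2 - normc a ^+ 2) * (normc (b k) ^+ 2 * rho ^+ k.*2).
rewrite (eq_bigr (fun k : 'I_m => g k - g k.+1)); last first.
  move=> k _; rewrite cR cL mulrA -mulrBl normc_blaschke /g doubleS !exprS /=; ring.
rewrite -(big_mkord xpredT (fun k => g k - g k.+1)).
rewrite (eq_bigr (fun k => - g k.+1 - - g k)) => [|k _]; last by rewrite opprK addrC.
(* Both ends vanish: [b 0] is 0 by definition, and [b m] is a coefficient of [q] past its size. *)
rewrite telescope_sumr // opprK /g /= nth_default ?leqnSn //.
by rewrite normc0 expr0n addr0 sqrtr0 expr0n /= !mul0r !mulr0 oppr0 addr0.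
Qed.

(** Each root is reflected in turn, its factor being absorbed into [q]: the norm gains [rho ^+ 2],
    while the constant term trades the factor [a] for [rho ^+ 2]. With no root left, the squared
    constant term is one summand of the norm. *)
Lemma landau_le (R : rcfType) (rho r : R) (s : seq R[i]) (q : {poly R[i]}) :
  0 < rho -> (forall a, a \in s -> normc a <= r) ->
  normc (\prod_(a <- s) ('X - a%:P) * q)`_0 ^+ 2 * rho ^+ (size s).*2
    <= r ^+ (size s).*2 * l2norm2 rho (\prod_(a <- s) ('X - a%:P) * q).
Proof.
move=> rho_gt0; elim: s q => [|a s IHs] q sr.
  rewrite big_nil mul1r !expr0 mulr1 mul1r.
  have [-> | q0] := eqVneq q 0.
    by rewrite coef0 normc0 expr0n /l2norm2 size_poly0 big_ord0.
  rewrite (@l2norm2E _ _ _ (size q).+1) // big_ord_recl mulr1 lerDl.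
  by apply: sumr_ge0 => k _; rewrite mulr_ge0 ?sqr_ge0 ?exprn_ge0 // ltW.
have rr := sr a (mem_head _ _).
have {}sr b : b \in s -> normc b <= r by move=> bs; rewrite sr // inE bs orbT.
have := IHs (((rho ^+ 2)%:C%:P - (a^*)%:P * 'X) * q) sr.
set P := \prod_(b <- s) _; rewrite big_cons -/P.
set B := _ - _ * 'X.
have -> : P * (B * q) = B * (P * q) by rewrite mulrCA.
have -> : ('X - a%:P) * P * q = ('X - a%:P) * (P * q) by rewrite mulrA.
rewrite l2norm2_blaschke.
have -> : (B * (P * q))`_0 = (rho ^+ 2)%:C * (P * q)`_0.
  by rewrite /B mulrBl coefB -mulrA !coefCM coefXM mulr0 subr0.
have -> : (('X - a%:P) * (P * q))`_0 = - (a * (P * q)`_0).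
  by rewrite mulrBl coefB coefXM coefCM sub0r.
rewrite normcN !normcM.
have -> : normc (rho ^+ 2)%:C = rho ^+ 2.
  by rewrite /= expr0n addr0 sqrtr_sqr ger0_norm // sqr_ge0.
set X := normc _; set L := l2norm2 _ _; set t := size s => H.
have A0 := normc_ge0 a.
have {}H : rho ^+ 2 * (X ^+ 2 * rho ^+ t.*2) <= r ^+ t.*2 * L.
  rewrite -(ler_pM2l (x := rho ^+ 2)) ?exprn_gt0 //.
  by apply: le_trans (le_trans H _); rewrite le_eqVlt; apply/orP; left; apply/eqP; ring.
have -> : (normc a * X) ^+ 2 * rho ^+ (size (a :: s)).*2
    = normc a ^+ 2 * (rho ^+ 2 * (X ^+ 2 * rho ^+ t.*2)).
  by rewrite /= doubleS !exprS -/t; ring.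
apply: (@le_trans _ _ (r ^+ 2 * (rho ^+ 2 * (X ^+ 2 * rho ^+ t.*2)))).
  rewrite ler_wpM2r //; last by rewrite ler_sqr ?nnegrE ?(le_trans A0 rr).
  have rho_ge0 := ltW rho_gt0; by rewrite !mulr_ge0 ?exprn_ge0 ?normc_ge0.
have -> : r ^+ (size (a :: s)).*2 * L = r ^+ 2 * (r ^+ t.*2 * L).
  by rewrite /= doubleS !exprS -/t; ring.
by rewrite ler_wpM2l // sqr_ge0.
Qed.

(** * The characteristic polynomial of a perturbed Jordan block *)

(** The inverse of 1 - X J^T, where J^T is the transposed Jordan block. *)
Definition geom_mx (K : comNzRingType) (n : nat) : 'M[{poly K}]_n :=
  \matrix_(i, j) if (j <= i)%N then 'X^(i - j) else 0.

Lemma det_geom_mx (K : comNzRingType) (n : nat) : \det (geom_mx K n) = 1.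
Proof.
rewrite det_trig; last first.
  apply/is_trig_mxP => i j lt_ij; by rewrite mxE leqNgt lt_ij.
by rewrite big1 // => i _; rewrite mxE leqnn subnn expr0.
Qed.

(* Multiplication by the unitriangular [geom_mx] moves the diagonal of [X - J]
   into the last row, leaving only entries of size [delta] above it apart from the
   superdiagonal. *)
Lemma char_poly_mx_geom (K : comNzRingType) (n : nat) (E : 'M[K]_n) (i j : 'I_n) :
  (char_poly_mx (shift_mx K n + E) *m geom_mx K n) i j
    = (if i.+1 == n then 'X^(n - j) else - (j == i.+1 :> nat)%:R)
      - \sum_k (E i k)%:P * geom_mx K n k j.
Proof.
rewrite /char_poly_mx raddfD /= opprD addrA mulmxBl mxE [X in _ + X]mxE.
congr (_ + - _); last first.
  by rewrite mxE; apply: eq_bigr => k _; rewrite !mxE.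
rewrite mulmxBl mul_scalar_mx mxE [X in _ + X]mxE [X in X - _]mxE.
rewrite [X in _ - X]mxE.
case: eqP => [i_last | /eqP i_nlast].
  rewrite big1 ?subr0 => [|k _]; last first.
    by rewrite !mxE (_ : _ == _ = false) ?mul0r //; apply/eqP => E1; have := ltn_ord k; lia.
  rewrite mxE ifT; last by have := ltn_ord j; lia.
  by rewrite -exprS; congr ('X^_); have := ltn_ord j; lia.
have lt_in : (i.+1 < n)%N by have := ltn_ord i; lia.
rewrite (bigD1 (Ordinal lt_in)) //= big1 ?addr0 => [|k ne_k]; last first.
  rewrite !mxE (_ : _ == _ = false) ?mul0r //.
  by apply: contraNF ne_k => /eqP E1; apply/eqP/val_inj.
rewrite !mxE eqxx mul1r /=.
case: ltngtP => [lt_ji|lt_ij|E1].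
- rewrite (_ : _ == _ = false) ?oppr0; last by apply/eqP; lia.
  rewrite leqW ?(ltnW lt_ji) //.
   by rewrite -exprS subSn ?subrr // ltnW.
- case: ltngtP => [|lt|E1]; first by lia.
    by rewrite mulr0 subr0 oppr0.
  by rewrite E1 subnn mulr0 sub0r.
- rewrite E1 leqnSn subSnn (_ : _ == _ = false) ?oppr0; last by apply/eqP; lia.
  by rewrite subnn mulr1 subrr.
Qed.

(** Bounds the norms at [rho = 1/3] along a column of [geom_mx]; 3/2 is the full geometric
    series. *)
Lemma geom_tail_le (R : realFieldType) (n j : nat) :
  \sum_(k < n) (if (j <= k)%N then (3^-1 : R) ^+ (k - j) else 0) <= 3 / 2.
Proof.
suff : \sum_(k < n) (if (j <= k)%N then (3^-1 : R) ^+ (k - j) else 0)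
    <= 3 / 2 * (1 - 3^-1 ^+ (n - j)).
  move/le_trans; apply; have : 0 <= (3^-1 : R) ^+ (n - j) by rewrite exprn_ge0 ?invr_ge0.
  lra.
elim: n => [|n IHn]; first by rewrite big_ord0 sub0n expr0 subrr mulr0.
rewrite big_ord_recr /=; case: leqP => [le_jn|lt_nj].
  by rewrite subSn // exprS; move: IHn; set x := 3^-1 ^+ _; lra.
have E1 : (n.+1 - j = n - j)%N by lia.
by rewrite addr0 E1.
Qed.

(** Needed for the last row, with the column weights 3k(k+2). The value 9 is that of the infinite
    series. *)
Lemma sum_geom_quad_le (R : realFieldType) (m : nat) :
  \sum_(k < m) (3^-1 : R) ^+ k.+1 * (3 * k.+1%:R * (k.+1%:R + 2)) <= 9.
Proof.
suff -> : \sum_(k < m) (3^-1 : R) ^+ k.+1 * (3 * k.+1%:R * (k.+1%:R + 2))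
    = 9 - 3^-1 ^+ m * (3 / 2 * m%:R ^+ 2 + 15 / 2 * m%:R + 9).
  have m_ge0 : 0 <= m%:R :> R by [].
  have x_ge0 : 0 <= (3^-1 : R) ^+ m by rewrite exprn_ge0 ?invr_ge0.
  by rewrite gerBl mulr_ge0 //; nra.
elim: m => [|m IHm]; first by rewrite big_ord0 expr0; field.
by rewrite big_ord_recr /= IHm !exprS -!natr1; field.
Qed.

(** Telescopes, each factor being (k+1)^2 / (k(k+2)) with k shifted by one; this dictates the shape
    of the column weights below. *)
Lemma prod_inv_quad_le (R : realFieldType) (m : nat) :
  \prod_(k < m) (1 + (k.+1%:R * (k.+1%:R + 2) : R)^-1) <= 2.
Proof.
suff -> : \prod_(k < m) (1 + (k.+1%:R * (k.+1%:R + 2) : R)^-1)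
    = 2 * (m%:R + 1) / (m%:R + 2).
  rewrite ler_pdivrMr ?ltr_wpDl // ?ler0n //; lra.
elim: m => [|m IHm]; first by rewrite big_ord0; field.
rewrite big_ord_recr /= IHm -!natr1.
have m_ge0 : 0 <= m%:R :> R by [].
by field; apply/and3P; split; apply/lt0r_neq0; lra.
Qed.

Lemma char_poly_geom (K : comNzRingType) (n : nat) (A : 'M[K]_n) :
  char_poly A = \det (char_poly_mx A *m geom_mx K n).
Proof. by rewrite det_mulmx det_geom_mx mulr1. Qed.

Lemma l1norm_geom_entry (R : rcfType) (n : nat) (delta : R) (E : 'M[R[i]]_n)
    (i j : 'I_n) : (forall i j, normc (E i j) <= delta) ->
  l1norm 3^-1 ((char_poly_mx (shift_mx R[i] n + E) *m geom_mx R[i] n) i j)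
    <= (if i.+1 == n then 3^-1 ^+ (n - j) else (j == i.+1 :> nat)%:R)
       + 3 / 2 * delta.
Proof.
move=> le_E; have delta_ge0 : 0 <= delta by apply: le_trans (le_E i j); apply: normc_ge0.
have fP : submult_norm (@l1norm R 3^-1) by apply: l1norm_submult; rewrite invr_ge0.
rewrite char_poly_mx_geom; apply: le_trans (sn_D fP _ _) _; rewrite (sn_N fP).
apply: lerD.
  case: ifP => _; first by rewrite l1normXn.
  rewrite (sn_N fP) -polyC_natr l1normC; case: (_ == _); by rewrite ?normc1 ?normc0.
apply: le_trans (sn_sum _ _ _ fP) _.
rewrite mulrC; apply: le_trans (ler_wpM2l delta_ge0 (geom_tail_le R n j)).
rewrite mulr_sumr; apply: ler_sum => k _.
apply: le_trans (sn_M fP _ _) _; rewrite l1normC mxE.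
apply: ler_pM; rewrite ?(sn_ge0 fP) ?normc_ge0 //.
by case: ifP => _; rewrite ?l1normXn ?(sn_0 fP).
Qed.

(** [sn_det] is applied after multiplication by [geom_mx], with [s] the cyclic permutation through
    the superdiagonal and the bottom left corner. *)
Lemma char_poly_l1norm_le (R : rcfType) (n : nat) (delta : R) (E : 'M[R[i]]_n) :
    (7 <= n)%N -> 0 < delta -> n%:R ^+ 5 * delta <= 1 -> 3^-1 ^+ n <= delta ->
    (forall i j, normc (E i j) <= delta) ->
  l1norm 3^-1 (char_poly (shift_mx R[i] n + E)) <= 26 * delta.
Proof.
case: n E => [//|m] E n_ge7 delta_gt0 n5delta geom_delta le_E.
have fP : submult_norm (@l1norm R 3^-1) by apply: l1norm_submult; rewrite invr_ge0.
(* The weight [1 / delta] of the first column balances its entries of size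
   [delta]; the others grow quadratically towards the left so that both
   [sum_j 3^-(n-j) d_j] and [prod_i (1 + O(1 / d_(i+1)))] stay bounded. *)
pose e (k : nat) : R := 3 * k%:R * (k%:R + 2).
pose d (j : 'I_m.+1) := if j == 0 :> nat then delta^-1 else e (m.+1 - j)%N.
have e_gt0 k : (0 < k)%N -> 0 < e k.
  by move=> k_gt0; rewrite !mulr_gt0 ?ltr0n // ltr_wpDl // ler0n.
have d_gt0 j : 0 < d j.
  rewrite /d; case: ifP => _; rewrite ?invr_gt0 // e_gt0 // subn_gt0; exact: ltn_ord.
have N_ge7 : 7 <= m.+1%:R :> R by rewrite (ler_nat R 7 m.+1).
(* The first column contributes exactly 1, the others together at most [n%:R ^+ 5 * delta]. *)
have sum_d : delta * \sum_j d j <= 2.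
  rewrite big_ord_recl mulrDr /d /= mulfV ?lt0r_neq0 //.
  have : delta * \sum_(i < m) e (m - i)%N <= delta * (m.+1%:R * e m.+1).
    rewrite ler_wpM2l ?(ltW delta_gt0) //.
    apply: (@le_trans _ _ (\sum_(i < m) e m.+1)).
      apply: ler_sum => k _; rewrite /e -!mulrA ler_wpM2l //.
      have : (m - k)%:R <= m.+1%:R :> R by rewrite ler_nat; lia.
      have : 0 <= (m - k)%:R :> R by [].
      move: (m - k)%:R => x; nra.
    rewrite sumr_const card_ord -[leLHS]mulr_natl ler_wpM2r ?(ltW (e_gt0 _ _)) //.
    by rewrite ler_nat.
  have : delta * (m.+1%:R * e m.+1) <= 1.
    apply: le_trans n5delta; rewrite mulrC ler_wpM2r ?(ltW delta_gt0) //.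
    rewrite /e; move: (m.+1%:R : R) N_ge7 => x x7.
    have -> : x * (3 * x * (x + 2)) = x ^+ 2 * (3 * (x + 2)) by ring.
    have -> : x ^+ 5 = x ^+ 2 * x ^+ 3 by ring.
    rewrite ler_wpM2l ?sqr_ge0 // !exprS expr0; nra.
  by lra.
pose s := perm (@ordS_inj m.+1).
rewrite char_poly_geom; apply: le_trans (sn_det _ s fP d_gt0) _.
have sE i : s i = (i.+1 %% m.+1)%N :> nat by rewrite permE.
pose a i j := l1norm 3^-1
  ((char_poly_mx (shift_mx R[i] m.+1 + E) *m geom_mx R[i] m.+1) i j).
rewrite big_ord_recr /=.
(* The rows above the last contribute the factor 2, the last row [13 * delta]. *)
have -> : 26 * delta = 2 * (13 * delta) by ring.
have row_ge0 i : 0 <= \sum_j a i j * d j / d (s i).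
  apply: sumr_ge0 => j _; rewrite divr_ge0 ?mulr_ge0 ?(sn_ge0 fP) //; exact: ltW.
apply: ler_pM.
- by apply: prodr_ge0 => i _; apply: row_ge0.
- exact: row_ge0.
- apply: le_trans (prod_inv_quad_le R m); rewrite [leRHS](reindex_inj rev_ord_inj) /=.
  apply: ler_prod => i _; rewrite row_ge0 /=.
  have lt_im := ltn_ord i.
  have -> : d (s (widen_ord (leqnSn m) i)) = e (m - i)%N.
    by rewrite /d sE /= modn_small ?ltnS //= subSS.
  have -> : (m - i.+1).+1 = (m - i)%N by lia.
  have e_i : 0 < e (m - i)%N by rewrite e_gt0 // subn_gt0.
  rewrite -mulr_suml ler_pdivrMr //.
  apply: (@le_trans _ _ (\sum_(j < m.+1) ((j == i.+1 :> nat)%:R * d j + 3 / 2 * delta * d j))).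
    apply: ler_sum => j _; rewrite -mulrDl ler_wpM2r ?(ltW (d_gt0 _)) //.
    apply: le_trans (l1norm_geom_entry _ _ le_E) _.
    by rewrite ifF //=; apply/eqP; lia.
  rewrite big_split /= -mulr_sumr.
  have lt_im' : (i.+1 < m.+1)%N by [].
  rewrite (bigD1 (Ordinal lt_im')) //= big1 => [|j ne_j]; last first.
    rewrite (_ : _ == _ = false) ?mul0r //.
    by apply: contraNF ne_j => /eqP E1; apply/eqP/val_inj.
  rewrite eqxx mul1r addr0 [leRHS]mulrDl mul1r.
  have -> : d (Ordinal lt_im') = e (m - i)%N by rewrite /d /= subSS.
  apply: lerD => //.
  have -> : ((m - i)%:R * ((m - i)%:R + 2))^-1 * e (m - i)%N = 3.
    rewrite /e -mulrA mulrCA mulVf ?mulr1 //.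
    by rewrite mulf_neq0 // lt0r_neq0 // ?ltr_wpDl ?ltr0n ?subn_gt0.
  by rewrite -mulrA; lra.
(* Dividing by this weight produces the factor [delta]. Of the remaining 13, the perturbation gives
   3, the power [3^-1 ^+ n] in the first column 1, the other columns 9. *)
- have -> : d (s ord_max) = delta^-1 by rewrite /d sE /= modnn.
  rewrite -mulr_suml invrK ler_wpM2r ?(ltW delta_gt0) //.
  apply: (@le_trans _ _ (\sum_(j < m.+1) (3^-1 ^+ (m.+1 - j) * d j + 3 / 2 * delta * d j))).
    apply: ler_sum => j _; rewrite -mulrDl ler_wpM2r ?(ltW (d_gt0 _)) //.
    apply: le_trans (l1norm_geom_entry _ _ le_E) _.
    by rewrite ifT //=.
  rewrite big_split /= -mulr_sumr.
  have : \sum_(j < m.+1) 3^-1 ^+ (m.+1 - j) * d j <= 10.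
    rewrite big_ord_recl {1}/d /= subn0.
    have : 3^-1 ^+ m.+1 / delta <= 1 by rewrite ler_pdivrMr // mul1r.
    have : \sum_(i < m) 3^-1 ^+ (m.+1 - lift ord0 i) * d (lift ord0 i) <= 9.
      apply: le_trans (sum_geom_quad_le R m); rewrite [leRHS](reindex_inj rev_ord_inj) /=.
      rewrite le_eqVlt; apply/orP; left; apply/eqP/eq_bigr => i _.
      have lt_im := ltn_ord i.
      rewrite /d /= subSS -/(e (m - i.+1).+1).
      by have -> : (m - i.+1).+1 = (m - i)%N by lia.
    lra.
  by rewrite -mulrA; lra.
Qed.

Lemma bernoulli_sub (R : realFieldType) (x : R) (m : nat) :
  0 <= x <= 1 -> 1 - m%:R * x <= (1 - x) ^+ m.
Proof.
move=> /andP[x_ge0 x_le1]; elim: m => [|m IHm]; first by rewrite mul0r subr0.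
rewrite exprS; apply: (@le_trans _ _ ((1 - x) * (1 - m%:R * x))).
  rewrite -natr1; have : 0 <= m%:R :> R by [].
  move: (m%:R : R) => y; nra.
by rewrite ler_wpM2l // subr_ge0.
Qed.

(** A division-free form of (1+x)^m <= 1/(1-mx), from Bernoulli and (1+x)(1-x) <= 1. *)
Lemma expr_1D_le (R : realFieldType) (x : R) (m : nat) :
  0 <= x <= 1 -> (1 + x) ^+ m * (1 - m%:R * x) <= 1.
Proof.
move=> x01; have /andP[x_ge0 x_le1] := x01.
apply: (@le_trans _ _ ((1 + x) ^+ m * (1 - x) ^+ m)).
  by rewrite ler_wpM2l ?bernoulli_sub // exprn_ge0 // addr_ge0.
rewrite -exprMn exprn_ile1 //; nra.
Qed.

(** If P is the modulus of the cyclic Leibniz term and Q the product of weighted row sums, the other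
    terms total at most Q - P, so the determinant has modulus at least 2P - Q. *)
Lemma normc_shift_det_ge (R : rcfType) (n : nat) (delta : R) (E : 'M[R[i]]_n) :
    (7 <= n)%N -> 0 < delta -> n%:R ^+ 5 * delta <= 1 ->
    (forall i j, normc (E i j) = delta) ->
  delta / 2 <= normc (\det (shift_mx R[i] n + E)).
Proof.
case: n E => [//|m] E n_ge7 delta_gt0 n5delta E_delta.
have fP := @normc_submult R.
have N_ge7 : 7 <= m.+1%:R :> R by rewrite (ler_nat R 7 m.+1).
have mE : m%:R = m.+1%:R - 1 :> R by rewrite -natr1 addrK.
set N : R := m.+1%:R in n5delta N_ge7 mE.
have N_ge0 : 0 <= N by [].
have N3delta : 49 * (N ^+ 3 * delta) <= 1.
  apply: le_trans n5delta.
  have -> : N ^+ 5 * delta = N ^+ 2 * (N ^+ 3 * delta) by ring.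
  rewrite ler_wpM2r ?mulr_ge0 ?exprn_ge0 ?(ltW delta_gt0) //.
  nra.
have Ndelta : 49 * (N * delta) <= N ^+ 3 * delta.
  have -> : N ^+ 3 * delta = N ^+ 2 * (N * delta) by ring.
  rewrite ler_wpM2r ?mulr_ge0 ?exprn_ge0 ?(ltW delta_gt0) //.
  nra.
(* The weight [N ^+ 2] brings the last row down to (1 + 1/N) [delta], while each other row sum stays
   below 1 + 2 N^2 [delta], harmless as N^3 [delta] <= 1/49. *)
pose d (j : 'I_m.+1) : R := if j == 0 :> nat then N ^+ 2 else 1.
have d_gt0 j : 0 < d j by rewrite /d; case: ifP => _ //; rewrite exprn_gt0 //; lra.
have sum_d : \sum_j d j = N ^+ 2 + m%:R.
  rewrite big_ord_recl {1}/d /= (eq_bigr (fun=> 1)) => [|i _]; last by rewrite /d.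
  by rewrite sumr_const card_ord.
pose s := perm (@ordS_inj m.+1).
have sE i : s i = (i.+1 %% m.+1)%N :> nat by rewrite permE.
set A := shift_mx _ _ + E.
have le_A i j : normc (A i j) <= (j == i.+1 :> nat)%:R + delta.
  rewrite /A !mxE -(E_delta i j); apply: le_trans (le_normcD _ _) _.
  by rewrite lerD2r; case: (_ == _); rewrite ?normc1 ?normc0.
have := sn_det_sub A s fP d_gt0.
set main := _ * \prod_i A i (s i).
have : \prod_i (\sum_j normc (A i j) * d j / d (s i)) <= 49 / 47 * (8 / 7 * delta).
  rewrite big_ord_recr /=.
  have row_ge0 i : 0 <= \sum_j normc (A i j) * d j / d (s i).
    apply: sumr_ge0 => j _; rewrite divr_ge0 ?mulr_ge0 ?normc_ge0 //; exact: ltW.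
  apply: ler_pM.
  - by apply: prodr_ge0 => i _; apply: row_ge0.
  - exact: row_ge0.
  - pose x := 2 * N ^+ 2 * delta.
    have x_ge0 : 0 <= x by rewrite !mulr_ge0 ?exprn_ge0 ?(ltW delta_gt0) //; lra.
    have mx : m%:R * x <= 2 / 49 by rewrite /x mE; nra.
    have x_le1 : x <= 1.
      by have : 1 <= m%:R :> R; [rewrite mE; lra | nra].
    have := @expr_1D_le _ x m; rewrite x_ge0 x_le1 => /(_ isT) exp_le.
    apply: (@le_trans _ _ ((1 + x) ^+ m)); last first.
      have : 0 <= (1 + x) ^+ m by rewrite exprn_ge0 ?addr_ge0.
      by move: exp_le; set y := _ ^+ m; nra.
    rewrite -[X in _ ^+ X]card_ord -prodr_const.
    apply: ler_prod => i _; rewrite row_ge0 /=.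
    have -> : d (s (widen_ord (leqnSn m) i)) = 1.
      by rewrite /d sE /= modn_small ?ltnS.
    apply: (@le_trans _ _ (\sum_(j < m.+1) ((j == i.+1 :> nat)%:R * d j + delta * d j))).
      apply: ler_sum => j _; by rewrite divr1 -mulrDl ler_wpM2r ?(ltW (d_gt0 _)) //.
    have lt_im' : (i.+1 < m.+1)%N by rewrite ltnS.
    rewrite big_split /= -mulr_sumr (bigD1 (Ordinal lt_im')) //= big1 => [|j ne_j]; last first.
      rewrite (_ : _ == _ = false) ?mul0r //.
      by apply: contraNF ne_j => /eqP E1; apply/eqP/val_inj.
    rewrite eqxx mul1r addr0 sum_d {1}/d /= lerD2l /x mE.
    by rewrite [leRHS]mulrC ler_wpM2l ?(ltW delta_gt0) //; nra.
  - have -> : d (s ord_max) = N ^+ 2 by rewrite /d sE /= modnn.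
    rewrite -mulr_suml ler_pdivrMr ?exprn_gt0 //.
    apply: (@le_trans _ _ (\sum_(j < m.+1) delta * d j)).
      apply: ler_sum => j _; rewrite ler_wpM2r ?(ltW (d_gt0 _)) //.
      apply: le_trans (le_A _ _) _; rewrite (_ : _ == _ = false) ?add0r //.
      by apply/eqP => /= E1; have := ltn_ord j; lia.
    rewrite -mulr_sumr sum_d mE; nra.
(* The superdiagonal entries have modulus at least 1 - [delta], and m [delta] <= 1/49^2. *)
have : (1 - 1 / 2401) * delta <= \prod_i normc (A i (s i)).
  rewrite big_ord_recr /=.
  have -> : normc (A ord_max (s ord_max)) = delta.
    rewrite -(E_delta ord_max (s ord_max)) /A !mxE sE modnn /=.
    by rewrite add0r.
  rewrite ler_wpM2r ?(ltW delta_gt0) //.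
  have delta_le1 : delta <= 1 by nra.
  apply: (@le_trans _ _ ((1 - delta) ^+ m)).
    have := @bernoulli_sub _ delta m; rewrite delta_le1 (ltW delta_gt0) => /(_ isT).
    rewrite mE; nra.
  rewrite -[X in _ ^+ X]card_ord -prodr_const.
  apply: ler_prod => i _; rewrite subr_ge0 delta_le1 /=.
  rewrite /A !mxE sE /= modn_small ?ltnS // eqxx /=.
  set z := E _ _; rewrite lerBlDr
    -(E_delta (widen_ord (leqnSn m) i) (s (widen_ord (leqnSn m) i))) -/z.
  by have := le_normcD (1 + z) (- z); rewrite addrK normcN normc1.
have : normc main = \prod_i normc (A i (s i)).
  rewrite /main sn_signM //; elim/big_rec2: _ => [|i y x _ <-]; first exact: normc1.
  by rewrite normcM.
have : normc main <= normc (\det A) + normc (\det A - main).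
  have := le_normcD (\det A) (- (\det A - main)).
  by rewrite normcN opprB addrC subrK.
lra.
Qed.

(** (16/9)^2 > 3, hence (16/9)^16 > 3^8 = 81^2. *)
Lemma exponent_le15 (R : realFieldType) (m : nat) :
  (16 / 9) ^+ m <= 52 ^+ 2 :> R -> (m <= 15)%N.
Proof.
move=> H; rewrite leqNgt; apply/negP => m_ge16; move: H; apply/negP; rewrite -ltNge.
have ge1 : 1 <= 16 / 9 :> R by lra.
apply: lt_le_trans (ler_weXn2l ge1 m_ge16).
have -> : 16%N = (2 * 8)%N by [].
rewrite exprM.
have le3 : 3 <= (16 / 9) ^+ 2 :> R by lra.
have {}le3 : (3 : R) ^+ 8 <= ((16 / 9) ^+ 2) ^+ 8.
  apply: lerXn2r; rewrite ?nnegrE // (le_trans _ le3) //.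
apply: lt_le_trans le3; have -> : 8%N = (4 * 2)%N by [].
rewrite exprM ltrXn2r //; lra.
Qed.

(** Landau's inequality with radii 1/4 and 1/3: [delta] cancels between the two estimates of the
    characteristic polynomial, leaving (16/9)^N <= 52^2 for N roots. *)
Lemma num_eig_inside_le (R : rcfType) (n : nat) (delta r : R) (E : 'M[R[i]]_n) :
    (7 <= n)%N -> 0 < delta -> n%:R ^+ 5 * delta <= 1 -> 3^-1 ^+ n <= delta ->
    (forall i j, normc (E i j) = delta) -> r <= 1 / 4 ->
  (num_eig_inside r (shift_mx R[i] n + E) <= 15)%N.
Proof.
move=> n_ge7 delta_gt0 n5delta geom_delta E_delta r_le.
have le_E i j : normc (E i j) <= delta by rewrite E_delta.
have up := char_poly_l1norm_le n_ge7 delta_gt0 n5delta geom_delta le_E.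
have low := normc_shift_det_ge n_ge7 delta_gt0 n5delta E_delta.
set A := _ + E in up low *.
rewrite /num_eig_inside -size_filter.
set s := eigenvalues A; set t := filter _ _.
pose q : {poly R[i]} := \prod_(z <- [seq z <- s | ~~ in_disk r z]) ('X - z%:P).
have pE : char_poly A = \prod_(z <- t) ('X - z%:P) * q.
  rewrite eigenvaluesP -/s /t /q !big_filter.
  by rewrite (bigID (fun z => in_disk r z)).
have third_gt0 : 0 < 3^-1 :> R by rewrite invr_gt0.
have t_le a : a \in t -> normc a <= 1 / 4.
  by rewrite mem_filter /in_disk -[`|a|]/((normc a)%:C) lecR => /andP[/le_trans-> //].
have := landau_le q third_gt0 t_le; rewrite -pE char_poly_det.
have -> : normc ((-1) ^+ n * \det A) = normc (\det A).
  by rewrite -signr_odd (sn_signM _ _ (@normc_submult R)).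
set N := size t => H.
have {}H : (delta / 2) ^+ 2 * 3^-1 ^+ N.*2 <= (1 / 4) ^+ N.*2 * (26 * delta) ^+ 2.
  apply: le_trans (le_trans H _).
    rewrite ler_wpM2r ?exprn_ge0 ?(ltW third_gt0) // lerXn2r ?nnegrE ?normc_ge0 //.
    by rewrite divr_ge0 ?(ltW delta_gt0).
  rewrite ler_wpM2l ?exprn_ge0 ?divr_ge0 //.
  apply: le_trans (l2norm2_le_l1norm _ (ltW third_gt0)) _.
  rewrite lerXn2r ?nnegrE //; last by rewrite mulr_ge0 ?(ltW delta_gt0).
  by rewrite (sn_ge0 (l1norm_submult (ltW third_gt0))).
have {}H : (16 / 9) ^+ N <= 52 ^+ 2 :> R.
  have E16 : (16 / 9 : R) ^+ N * (1 / 4) ^+ N.*2 = 3^-1 ^+ N.*2.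
    by rewrite -mul2n !exprM -exprMn; congr (_ ^+ _); field.
  rewrite -(ler_pM2r (x := delta ^+ 2 / 4 * (1 / 4) ^+ N.*2)); last first.
    by rewrite mulr_gt0 ?divr_gt0 ?exprn_gt0 ?divr_gt0.
  have -> : (16 / 9) ^+ N * (delta ^+ 2 / 4 * (1 / 4) ^+ N.*2)
      = (delta / 2) ^+ 2 * 3^-1 ^+ N.*2.
    by rewrite -E16; set x := (16 / 9) ^+ N; set y := _ ^+ N.*2; field.
  have -> // : 52 ^+ 2 * (delta ^+ 2 / 4 * (1 / 4) ^+ N.*2)
      = (1 / 4) ^+ N.*2 * (26 * delta) ^+ 2.
  by set y := _ ^+ N.*2; field.
exact: (@exponent_le15 R).
Qed.

Lemma shift_eigenvalue_bound (R : rcfType) (n : nat) (delta : R) (E : 'M[R[i]]_n)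
    (z : R[i]) :
  (forall i j, normc (E i j) = delta) -> n%:R ^+ 2 * 5 ^+ n * delta < 1 ->
  root (char_poly (shift_mx R[i] n + E)) z -> normc z < 1 / 5.
Proof.
move=> E_delta small; rewrite -eigenvalue_root_char => /eigenvalueP[v vA v_neq0].
rewrite ltNge; apply/negP => z_ge.
have [j0 v_j0] : exists j, v 0 j != 0.
  apply/existsP; apply: contraNT v_neq0; rewrite negb_exists => /forallP v0.
  by apply/eqP/rowP => j; rewrite mxE; apply/eqP; have := v0 j; rewrite negbK.
have delta_ge0 : 0 <= delta by rewrite -(E_delta j0 j0) normc_ge0.
pose S := \sum_j normc (v 0 j).
have S_gt0 : 0 < S.
  rewrite /S (bigD1 j0) //= ltr_pwDl ?sumr_ge0 // => [|j _]; last exact: normc_ge0.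
  by rewrite lt_neqAle normc_ge0 andbT eq_sym; apply: contra v_j0 => /eqP/eq0_normc->.
have z_gt0 : 0 < normc z by lra.
have e_le (j : 'I_n) : normc (\sum_k v 0 k * E k j) <= delta * S.
  apply: le_trans (sn_sum _ _ _ (@normc_submult R)) _.
  by rewrite /S mulr_sumr; apply: ler_sum => k _; rewrite normcM E_delta mulrC.
(* Column j of the eigenvector equation gives [v_(j-1)] up to an error [delta * S]; dividing by [z]
   costs at most a factor 5 per column. *)
have v_le k (j : 'I_n) : j = k :> nat ->
    normc (v 0 j) <= k.+1%:R * 5 ^+ k.+1 * (delta * S).
  elim: k j => [|k IHk] j jk.
  - have vzj : z * v 0 j = \sum_k v 0 k * E k j.
      have /rowP/(_ j) := vA; rewrite !mxE => <-.
      apply: eq_bigr => k _; rewrite !mxE jk /= add0r //.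
    have := e_le j; rewrite -vzj normcM; have := normc_ge0 (v 0 j).
    rewrite mul1r expr1; set x := normc (v 0 j); set y := delta * S.
    by move=> x_ge0 H; nra.
  - have lt_kn : (k < n)%N by have := ltn_ord j; lia.
    have vzj : z * v 0 j = v 0 (Ordinal lt_kn) + \sum_k v 0 k * E k j.
      have /rowP/(_ j) := vA; rewrite !mxE => <-.
      under eq_bigr do rewrite !mxE mulrDr.
      rewrite big_split /=; congr (_ + _).
      rewrite (bigD1 (Ordinal lt_kn)) //= jk eqxx mulr1 big1 ?addr0 // => i ne_i.
      rewrite (_ : _ == _ = false) ?mulr0 //.
      by apply: contraNF ne_i => /eqP[E1]; apply/eqP/val_inj.
    have := IHk (Ordinal lt_kn) erefl; have := e_le j.
    have : normc z * normc (v 0 j)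
        <= normc (v 0 (Ordinal lt_kn)) + normc (\sum_k v 0 k * E k j).
      by rewrite -normcM vzj le_normcD.
    have := normc_ge0 (v 0 j); have : 0 <= delta * S by rewrite mulr_ge0 ?(ltW S_gt0).
    rewrite (exprS _ k.+1) -(natr1 k.+1).
    have : 1 <= 5 ^+ k.+1 :> R by rewrite exprn_ege1 //; lra.
    set p := 5 ^+ k.+1; set q := k.+1%:R; set x := normc (v 0 j).
    set w := normc (v 0 (Ordinal lt_kn)); set e := normc (\sum_k _).
    set y := delta * S => p_ge1 y_ge0 x_ge0 H1 H2 H3.
    have : 1 / 5 * x <= q * p * y + y by nra.
    have : y <= p * y by nra.
    by nra.
(* Summing the entrywise bounds would give S < S. *)
suff : S <= n%:R ^+ 2 * 5 ^+ n * delta * S by rewrite leNgt -[X in _ < X]mul1r ltr_pM2r ?small.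
have -> : n%:R ^+ 2 * 5 ^+ n * delta * S = \sum_(j < n) n%:R * 5 ^+ n * (delta * S).
  by rewrite sumr_const card_ord -[RHS]mulr_natl; ring.
apply: ler_sum => j _; apply: le_trans (v_le j j erefl) _.
rewrite ler_wpM2r ?mulr_ge0 ?(ltW S_gt0) //.
have lt_jn := ltn_ord j.
apply: ler_pM; rewrite ?exprn_ge0 ?ler0n // ?ler_nat //.
by rewrite ler_weXn2l //; lra.
Qed.

(** * The two regimes *)

(** (6/5)^6 <= 3 and ln(6/5) = - ln(1 - 1/6) >= 1/6. *)
Lemma ln3_ge1 (R : realType) : 1 <= ln (3 : R).
Proof.
have := @le_ln1Dx R (- (1 / 6)) _; have -> : 1 + - (1 / 6) = (6 / 5)^-1 :> R by field.
rewrite lnV ?posrE ?divr_gt0 // => H.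
have : 6%:R * ln (6 / 5) <= ln 3 :> R.
  rewrite mulr_natl -lnXn ?divr_gt0 // ler_ln ?posrE ?exprn_gt0 ?divr_gt0 //; lra.
have : - ln (6 / 5) <= - (1 / 6) :> R by apply: H; lra.
lra.
Qed.

(** 5 <= (6/5)^9 and ln(6/5) <= 1/5. *)
Lemma ln5_le (R : realType) : ln (5 : R) <= 9 / 5.
Proof.
have H : ln (1 + 1 / 5) <= 1 / 5 :> R by apply: le_ln1Dx; lra.
have : ln 5 <= 9%:R * ln (1 + 1 / 5) :> R.
  rewrite mulr_natl -lnXn; last lra.
  rewrite ler_ln ?posrE ?exprn_gt0 //; lra.
lra.
Qed.

(** With L = ln x, the logarithm is 2L + x ln 5 - [gamma] L; since x ln 5 <= (9/10) [gamma] L, it is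
    negative once [gamma] > 20. *)
Lemma small_n_bound (R : realType) (n : nat) (gamma : R) :
    (200 < n)%N -> 5 <= gamma -> n%:R <= 1 / 2 * (gamma * ln gamma) ->
  n%:R ^+ 2 * 5 ^+ n * n%:R `^ (- gamma) < 1.
Proof.
move=> n_gt gamma_ge5; set x : R := n%:R => x_le.
have x_gt : 200 < x by rewrite /x (ltr_nat R 200 n).
have x_gt0 : 0 < x by lra.
have gamma_gt0 : 0 < gamma by lra.
(* Otherwise ln [gamma] < [gamma] would give n <= 20^2 / 2 = 200, whence the threshold on n. *)
have gamma_gt20 : 20 < gamma.
  rewrite ltNge; apply/negP => gamma_le20.
  have := ln_sublinear gamma_gt0; nra.
have lnx_ge2 : 2 <= ln x.
  have := ln3_ge1 R; have : 2%:R * ln 3 <= ln x.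
    by rewrite mulr_natl -lnXn ?divr_gt0 // ler_ln ?posrE ?exprn_gt0 ?divr_gt0 //; lra.
  lra.
have x_le' : x <= 1 / 2 * (gamma * ln x).
  have [le_gx | lt_xg] := leP gamma x.
    have : ln gamma <= ln x by rewrite ler_ln ?posrE.
    nra.
  nra.
rewrite -ltr_ln ?posrE ?mulr_gt0 ?exprn_gt0 ?powR_gt0 //.
rewrite ln1 !lnM ?posrE ?mulr_gt0 ?exprn_gt0 ?powR_gt0 //.
rewrite !lnXn // ln_powR.
have := ln5_le R; move: (ln 5) (ln x) lnx_ge2 x_le' => a L L_ge2 x_le' a_le.
nra.
Qed.

(** It suffices that [gamma] ln x <= x, as ln 3 >= 1. The tangent to ln at [x0] reduces this to
    [x0], where ln [x0] <= 2 ln [gamma], the slope [gamma / x0] being at most 1. *)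
Lemma large_n_bound (R : realType) (n : nat) (gamma : R) :
    5 <= gamma -> 2 * (gamma * ln gamma) <= n%:R ->
  3^-1 ^+ n <= n%:R `^ (- gamma).
Proof.
move=> gamma_ge5; set x : R := n%:R; set x0 := 2 * _ => x_ge.
have gamma_gt0 : 0 < gamma by lra.
have lng_ge1 : 1 <= ln gamma.
  by apply: le_trans (ln3_ge1 R) _; rewrite ler_ln ?posrE //; lra.
have x0_gt0 : 0 < x0 by rewrite /x0; nra.
have x_gt0 : 0 < x by lra.
have ln_x : ln x <= x / x0 - 1 + ln x0.
  have -> : ln x = ln (1 + (x / x0 - 1)) + ln x0.
    by rewrite (addrC 1) subrK -lnM ?posrE ?divr_gt0 // divfK // lt0r_neq0.
  rewrite lerD2r; apply: le_ln1Dx.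
  have : 0 < x / x0 by rewrite divr_gt0.
  lra.
have ln_half : ln gamma <= gamma / 2.
  have -> : ln gamma = ln (1 + (gamma / 2 - 1)) + ln (1 + 1).
    have {1}-> : gamma = gamma / 2 * (1 + 1) by field.
    by rewrite lnM ?posrE ?divr_gt0 ?addr_gt0 // [1 + (_ - 1)]addrC subrK.
  have : ln (1 + 1) <= 1 :> R by apply: le_ln1Dx; lra.
  have : ln (1 + (gamma / 2 - 1)) <= gamma / 2 - 1 by apply: le_ln1Dx; lra.
  lra.
have ln_x0 : ln x0 <= 2 * ln gamma.
  rewrite /x0 mulrCA lnM ?posrE //; last lra.
  have : ln (2 * ln gamma) <= ln gamma by rewrite ler_ln ?posrE //; lra.
  lra.
have x_x0 : gamma * (x / x0 - 1) <= x - x0.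
  have -> : x - x0 = x0 * (x / x0 - 1) by rewrite mulrBr mulr1 mulrC divfK // lt0r_neq0.
  rewrite ler_wpM2r ?subr_ge0 ?ler_pdivlMr ?mul1r // /x0; nra.
have gamma_lnx : gamma * ln x <= x.
  have x0E : x0 = gamma * (2 * ln gamma) by rewrite /x0; ring.
  have : gamma * ln x <= gamma * (x / x0 - 1) + gamma * (2 * ln gamma).
    rewrite -mulrDr ler_wpM2l ?(ltW gamma_gt0) //; lra.
  by rewrite -x0E; lra.
rewrite powRN exprVn lef_pV2 ?posrE ?powR_gt0 ?exprn_gt0 //.
rewrite -ler_ln ?posrE ?powR_gt0 ?exprn_gt0 // ln_powR lnXn // -[leRHS]mulr_natl.
by apply: le_trans gamma_lnx _; rewrite ler_peMr ?ln3_ge1 // ltW.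
Qed.

Lemma size_eigenvalues (F : closedFieldType) (n : nat) (A : 'M[F]_n) :
  size (eigenvalues A) = n.
Proof.
have := size_char_poly A; rewrite eigenvaluesP size_prod_XsubC => /eqP.
by rewrite eqSS => /eqP.
Qed.

Theorem proposition5p1 (R : realType) (eps : R) (eps_gt0 : 0 < eps)
    (eps_lt : eps < 1 / 20) :
  exists C : nat,
    forall (n : nat) (gamma : R) (E : 'M[R[i]]_n),
      (7 <= n)%N -> 5 <= gamma ->
      sign_mx (n%:R `^ (- gamma))%:C E ->
      (n%:R <= 1 / 2 * (gamma * ln gamma) ->
         (num_eig_outside (1 / 4 - eps) (shift_mx R[i] n + E)%R <= C)%N) /\
      (2 * (gamma * ln gamma) <= n%:R ->
         (num_eig_inside (1 / 4 - eps) (shift_mx R[i] n + E)%R <= C)%N).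
Proof.
(* For n <= 200 all eigenvalues are counted; beyond that none lies outside, because 1/5 < 1/4 -
   [eps]. *)
exists 200%N => n gamma E n_ge7 gamma_ge5 signE.
have n_gt0 : 0 < n%:R :> R by rewrite ltr0n; lia.
set delta := n%:R `^ (- gamma) in signE.
have delta_gt0 : 0 < delta by rewrite powR_gt0.
have E_delta i j : normc (E i j) = delta.
  have nd : normc delta%:C = delta.
    by rewrite /= expr0n addr0 sqrtr_sqr ger0_norm // ltW.
  by case: (signE i j) => ->; rewrite ?normcN nd.
split => [n_le | n_ge].
  have [n_le200 | n_gt200] := leqP n 200.
    by apply: leq_trans (count_size _ _) _; rewrite size_eigenvalues.
  rewrite /num_eig_outside (_ : count _ _ = 0%N) //.
  apply/eqP; rewrite eqn0Ngt -has_count; apply/hasPn => z z_eig; rewrite negbK.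
  have z_root : root (char_poly (shift_mx R[i] n + E)) z.
    by rewrite eigenvaluesP root_prod_XsubC.
  have := shift_eigenvalue_bound E_delta (small_n_bound n_gt200 gamma_ge5 n_le) z_root.
  rewrite /in_disk -[`|z|]/((normc z)%:C) lecR; lra.
apply: leq_trans (_ : 15 <= 200)%N; last by [].
apply: (num_eig_inside_le n_ge7 delta_gt0 _ (large_n_bound gamma_ge5 n_ge) E_delta).
  (* n^5 n^(-[gamma]) = n^(5 - [gamma]) <= 1: this is where [gamma] >= 5 enters. *)
  rewrite -powR_mulrn ?ler0n // -powRD; last by rewrite (lt0r_neq0 n_gt0) implybT.
  have n_ge1 : 1 <= n%:R :> R by rewrite (ler_nat R 1 n) (leq_trans _ n_ge7).
  by rewrite -[leRHS](powRr0 n%:R); apply: (ler_powR n_ge1); lra.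
lra.
Qed.
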